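(* Let $n\ge2$, $k\in\{1,\dots,n-1\}$ and $H=\mathrm{lin}\{\mathrm{e}_1,\dots,\mathrm{e}_k\}\subset\mathbb{R}^n$. Let $K\subset\mathbb{R}^n$ be a convex bounded set containing the origin. Then \[ \left[\sum_{i=0}^{n-k}\frac{k}{n-i}\binom{n-k}{i}\binom{n}{i}^{-1} \mathrm{G}_{n-k}(P_{H^\perp} K)^{i/(n-k)}\right]\mathrm{G}_{k}(K\cap H) \leq\mathrm{G}_{n}\bigl(K+(-1,1)^n\bigr). \]
   Context: $\mathrm{e}_i$ is the $i$-th canonical unit vector of $\mathbb{R}^n$, $\mathrm{lin}$ denotes linear hull, $H^\perp$ is the orthogonal complement of $H$, and $P_{H^\perp}$ is the orthogonal projection onto $H^\perp$. For $M\subset\mathbb{R}^n$, $\mathrm{G}_n(M)=|M\cap\mathbb{Z}^n|$; for $M\subset H$, $\mathrm{G}_k(M)=|M\cap(\mathbb{Z}^k\times\{0_{n-k}\})|$; for $M\subset H^\perp$, $\mathrm{G}_{n-k}(M)=|M\cap(\{0_k\}\times\mathbb{Z}^{n-k})|$. The sum $A+B=\{a+b:a\in A,\ b\in B\}$ is the Minkowski sum. *)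

(* Defs.v *)
From HB Require Import structures.
From mathcomp Require Import all_boot all_order all_algebra.
From mathcomp Require Import finmap.
From mathcomp Require Import all_classical all_reals all_analysis.

Set Implicit Arguments.
Unset Strict Implicit.
Unset Printing Implicit Defensive.

Import Order.TTheory GRing.Theory Num.Theory.
Import numFieldNormedType.Exports.

Local Open Scope classical_set_scope.
Local Open Scope ring_scope.

Definition dotrv (R : realType) (n : nat) (u v : 'rV[R]_n) : R :=
  \sum_i u 0 i * v 0 i.

Section DotrvDot.
Variables (R : realType) (n : nat).

Let dotrv_bilinear :
  bilinear_for (GRing.Scale.Law.clone _ _ ( *%R ) _)
    (GRing.Scale.Law.clone _ _ (idfun \; *%R ) _) (@dotrv R n).
Proof.
split=> [v|v] a x y; rewrite /dotrv /= mulr_sumr -big_split /=;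
  apply: eq_bigr => i _; rewrite !mxE.
- by rewrite mulrDl mulrA.
- by rewrite mulrDr mulrCA.
Qed.

HB.instance Definition _ := bilinear_isBilinear.Build R _ _ _
  (GRing.Scale.Law.clone _ _ ( *%R ) _)
  (GRing.Scale.Law.clone _ _ (idfun \; *%R ) _) (@dotrv R n) dotrv_bilinear.

Let dotrv_hermitian (u v : 'rV[R]_n) :
  dotrv u v = (-1) ^+ false * idfun (dotrv v u).
Proof. by rewrite expr0 mul1r; apply: eq_bigr => i _; rewrite mulrC. Qed.

HB.instance Definition _ :=
  @isHermitianSesquilinear.Build _ _ _ _ (@dotrv R n) dotrv_hermitian.

Let dotrv_gt0 (u : 'rV[R]_n) : u != 0 -> 0 < dotrv u u.
Proof.
move=> u0; have sq_ge0 i : true -> 0 <= u 0 i * u 0 i.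
  by rewrite -expr2 sqr_ge0.
rewrite lt_def sumr_ge0 // andbT.
apply: contra_neq u0 => /eqP; rewrite psumr_eq0 // => /allP u0.
apply/rowP => i; rewrite mxE; apply/eqP.
by have := u0 i (mem_index_enum i); rewrite mulf_eq0 orbb.
Qed.

HB.instance Definition _ := isDotProduct.Build R _ (@dotrv R n) dotrv_gt0.

End DotrvDot.

Definition ortho_compl (R : realType) (n : nat) (U : {vspace 'rV[R]_n}) :
  {vspace 'rV[R]_n} := orthov (@dotrv R n) U.

Definition ortho_proj (R : realType) (n : nat) (U : {vspace 'rV[R]_n}) :
  'End('rV[R]_n) := daddv_pi U (ortho_compl U).

Definition coord_space (R : realType) (n k : nat) : {vspace 'rV[R]_n} :=
  <<[seq delta_mx 0%R i | i : 'I_n <- enum 'I_n & (i < k)%N]>>%VS.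

(* The points of R^n with integer coordinates at the indices in I and zero
   coordinates elsewhere: Z^n, Z^k x {0} and {0} x Z^(n-k) are the cases
   I = predT, I = [pred i | i < k] and I = [pred i | k <= i]. *)
Definition int_points (R : realType) (n : nat) (I : pred 'I_n) :
    set 'rV[R]_n :=
  [set x | forall i, if I i then x 0 i \is a Num.int else x 0 i == 0].

(* [fset_set] sends infinite sets to the empty set, so these counts are
   meaningful only when M contains finitely many of the points counted, e.g.
   when M is bounded. *)
Definition lattice_count (R : realType) (n : nat) (M : set 'rV[R]_n) : nat :=
  #|` fset_set (M `&` int_points predT)|.

Definition lattice_count_first (R : realType) (n k : nat)
    (M : set 'rV[R]_n) : nat :=
  #|` fset_set (M `&` int_points [pred i : 'I_n | (i < k)%N])|.

Definition lattice_count_last (R : realType) (n k : nat)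
    (M : set 'rV[R]_n) : nat :=
  #|` fset_set (M `&` int_points [pred i : 'I_n | (k <= i)%N])|.

Definition open_unit_cube (R : realType) (n : nat) : set 'rV[R]_n :=
  [set x | forall i, -1 < x 0 i < 1].
Arguments open_unit_cube : clear implicits.

Definition minkowski_sum (R : realType) (n : nat) (A B : set 'rV[R]_n) :
    set 'rV[R]_n :=
  [set a + b | a in A & b in B].

(* Main.v *)
(** For t in [0,1] let N(t) be the number of integer points y of the last n-k
    coordinates lying within sup-distance 1 of t p for some integer point p of
    P K.  The fiber of K + (-1,1)^n over such a y contains the integer points
    within distance 1 of (1-t)(K & H) + t x, where x in K lies over p.  A
    discrete Brunn-Minkowski inequality, proved by induction on the number of
    coordinates, bounds this fiber below by (1-t)^k G_k(K & H), and
    N(t) below by (1-t+t a)^(n-k) with a = G_(n-k)(P K)^(1/(n-k)).  Summing over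
    y by layers bounds G_n(K + (-1,1)^n) / G_k(K & H) below by every left
    Riemann sum of (1-t+t a)^(n-k) against -d(1-t)^k, hence by the integral,
    whose expansion in powers of a is the bracket of the theorem. *)
Require Import Defs.
From mathcomp Require Import all_boot all_order all_algebra.
From mathcomp Require Import finmap zify ring lra.
From mathcomp Require Import all_classical all_reals all_analysis.

Set Implicit Arguments.
Unset Strict Implicit.
Unset Printing Implicit Defensive.

Import Order.TTheory GRing.Theory Num.Theory.
Import numFieldNormedType.Exports.

Local Open Scope classical_set_scope.
Local Open Scope ring_scope.

(** * Counting integers near a scaled set of integers *)

Lemma ex_fset_argmax (R : realType) (T : choiceType) (S : {fset T}) (f : T -> R) :
  S != fset0 -> exists2 x, x \in S & forall y, y \in S -> f y <= f x.
Proof.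
case/fset0Pn=> x0 x0S.
case: (@arg_maxP _ _ _ [` x0S]%fset predT (fun y : S => f (val y)) isT) => x _ xmax.
by exists (val x) => [|y yS]; [exact: valP | exact: (xmax [` yS]%fset)].
Qed.

(* The term [ceil x - x] at the rightmost point x makes the bound inductive:
   it records how much of the last covered integer is still unpaid for. *)
Lemma near_int_count_strong (R : realType) (t v : R) (m : nat) (S Z : {fset R}) :
  0 <= t -> t <= 1 ->
  #|` S| = m.+1 -> {subset S <= Num.int} ->
  (forall j z, j \in S -> z \is a Num.int -> `|z - (t * j + v)| < 1 -> z \in Z) ->
  exists2 b, b \in S /\ (forall j, j \in S -> j <= b) &
    1 + t * m%:R + ((Num.ceil (t * b + v))%:~R - (t * b + v)) <= #|` Z|%:R.
Proof.
move=> t0 t1; elim: m S Z => [|m IH] S Z cardS Sint nearZ.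
  have [b bS bmax] : exists2 x, x \in S & forall y, y \in S -> y <= x.
    by apply: (@ex_fset_argmax _ _ S id); rewrite -cardfs_gt0 cardS.
  exists b => //; set x : R := t * b + v; pose c : R := (Num.ceil x)%:~R.
  have /andP[cx xc] := ceil_itv x; rewrite rmorphB /= -/c in cx; rewrite -/c in xc.
  have cint : c \is a Num.int by exact: intr_int.
  have cZ : c \in Z by apply: (nearZ b) => //; rewrite -/x ltr_norml; lra.
  have [cx0|cxN] := eqVneq c x.
    have : (1 <= #|` Z|)%N by rewrite cardfs_gt0; apply/fset0Pn; exists c.
    by rewrite -(ler_nat R) -/c; lra.
  have c1Z : c - 1 \in Z.
    apply: (nearZ b); rewrite ?rpredB ?rpred1 //.
    by rewrite -/x ltr_norml; lra.
  have : ([fset c; c - 1] `<=` Z)%fset by rewrite fsubUset !fsub1set cZ c1Z.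
  move/fsubset_leq_card; rewrite cardfs2 -(ler_nat R).
  have -> : c != c - 1 by rewrite gt_eqF //; lra.
  by rewrite /=; lra.
have [b bS bmax] : exists2 x, x \in S & forall y, y \in S -> y <= x.
  by apply: (@ex_fset_argmax _ _ S id); rewrite -cardfs_gt0 cardS.
exists b => //; set x : R := t * b + v; pose c : R := (Num.ceil x)%:~R.
have /andP[cx xc] := ceil_itv x; rewrite rmorphB /= -/c in cx; rewrite -/c in xc.
have cardS' : #|` S `\ b|%fset = m.+1.
  by have := cardfsD1 b S; rewrite bS cardS => -[].
have S'int : {subset (S `\ b)%fset <= Num.int}.
  by move=> j /fsetD1P[_ /Sint].
have [b' b'S' b'max] : exists2 x, x \in (S `\ b)%fset & forall y, y \in (S `\ b)%fset -> y <= x.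
  by apply: (@ex_fset_argmax _ _ _ id); rewrite -cardfs_gt0 cardS'.
set x' : R := t * b' + v; pose c' : R := (Num.ceil x')%:~R.
have /andP[cx' xc'] := ceil_itv x'; rewrite rmorphB /= -/c' in cx'; rewrite -/c' in xc'.
(* Integers within distance 1 of the remaining points are below [x' + 1], hence at most [c']. So the
   induction hypothesis applies to [Z'], and [c], [c - 1] are new as soon as they exceed [c']. *)
pose Z' := [fset z in Z | z <= c']%fset.
have [j z jS' zint zj|b'' [b''S' b''max]] := IH _ Z' cardS' S'int.
  rewrite !inE /=; have /fsetD1P[_ jS] := jS'; rewrite (nearZ j) //=.
  have : t * j <= t * b' by rewrite ler_wpM2l // b'max.
  move: zj; rewrite ltr_norml => /andP[_ zj] tj.
  have zc : z < c' + 1 by rewrite /x' in xc' *; lra.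
  move: zc; rewrite /c'; case/intrP: zint => k ->.
  by rewrite -[1]/(1%:~R) -rmorphD /= ltr_int ler_int ltzD1.
have -> : b'' = b' by apply: le_anti; rewrite b'max // b''max.
rewrite -/x -/x' -/c -/c' => IHb.
have /fsetD1P[b'b b'S] := b'S'.
have b'1 : b' + 1 <= b.
  have : b' < b by rewrite lt_neqAle b'b bmax.
  case/intrP: (Sint _ b'S) => i ->; case/intrP: (Sint _ bS) => j ->.
  by rewrite -[1]/(1%:~R) -rmorphD /= ltr_int ler_int lezD1.
have xx' : x' + t <= x.
  have : t * (b' + 1) <= t * b by rewrite ler_wpM2l.
  by rewrite /x /x'; lra.
have Z'Z : (Z' `<=` Z)%fset by apply/fsubsetP => z; rewrite !inE => /andP[].
have cint : c \is a Num.int by exact: intr_int.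
have c'int : c' \is a Num.int by exact: intr_int.
have cZ : c \in Z by apply: (nearZ b) => //; rewrite -/x ltr_norml; lra.
have gap (p q : R) : p \is a Num.int -> q \is a Num.int -> p < q -> p + 1 <= q.
  case/intrP=> i ->; case/intrP => j ->.
  by rewrite -[1]/(1%:~R) -rmorphD /= ltr_int ler_int lezD1.
have mS : m.+1%:R = m%:R + 1 :> R by rewrite natr1.
rewrite {}mS.
(* If [c <= c'], the rounding term drops by at least [t] and no new integer is needed. If
   [c = c' + 1], the new integer [c] pays for the rise of the ceiling. With a larger gap, [c] pays
   for [t <= 1], and [c - 1] pays for the rounding term when [x] is not an integer. *)
have [cc'|cc'] := leP c c'.
  have : (#|` Z'| <= #|` Z|)%N by exact: fsubset_leq_card.
  by rewrite -(ler_nat R); lra.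
have cardcZ' : #|` c |` Z'|%fset = #|` Z'|.+1.
  by rewrite cardfsU1 !inE (lt_geF cc') andbF.
have cc1 := gap _ _ c'int cint cc'.
have [ceq|cne] := eqVneq c (c' + 1).
  have : (c |` Z' `<=` Z)%fset by rewrite fsubUset fsub1set cZ.
  by move/fsubset_leq_card; rewrite cardcZ' -(ler_nat R) -natr1; lra.
have cc2 : c' + 1 + 1 <= c by apply: gap; rewrite ?rpredD ?rpred1 // lt_neqAle eq_sym cne.
have [cx0|cxN] := eqVneq c x.
  have : (c |` Z' `<=` Z)%fset by rewrite fsubUset fsub1set cZ.
  by move/fsubset_leq_card; rewrite cardcZ' -(ler_nat R) -natr1; lra.
have c1Z : c - 1 \in Z.
  apply: (nearZ b); rewrite ?rpredB ?rpred1 //.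
  by rewrite -/x ltr_norml; lra.
have : ((c - 1) |` (c |` Z') `<=` Z)%fset by rewrite !fsubUset !fsub1set cZ c1Z.
move/fsubset_leq_card; rewrite cardfsU1 cardcZ'.
have -> : c - 1 \notin (c |` Z')%fset.
  rewrite !inE negb_or negb_and -ltNge lt_eqF ?orTb //=; last by lra.
  by apply/orP; right; lra.
by rewrite /= -(ler_nat R) natrD -natr1; lra.
Qed.

Lemma near_int_count (R : realType) (t v : R) (S Z : {fset R}) :
  0 <= t -> t <= 1 ->
  S != fset0 -> {subset S <= Num.int} ->
  (forall j z, j \in S -> z \is a Num.int -> `|z - (t * j + v)| < 1 -> z \in Z) ->
  1 - t + t * #|` S|%:R <= #|` Z|%:R.
Proof.
move=> t0 t1; rewrite -cardfs_gt0; case cardS : #|` S| => [//|m] _ Sint nearZ.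
have [b _] := near_int_count_strong t0 t1 cardS Sint nearZ.
have := ceil_ge (t * b + v); rewrite -natr1; lra.
Qed.

(* Layer-cake summation of [near_int_count] over the superlevel sets of c:
   the lowest layer is peeled off at each step. *)
Lemma near_int_sum (R : realType) (t v : R) (S Z : {fset R}) (c tau : R -> R) j0 :
  0 <= t -> t <= 1 ->
  {subset S <= Num.int} -> j0 \in S ->
  (forall j, j \in S -> 0 <= c j) -> (forall z, z \in Z -> 0 <= tau z) ->
  (forall j z, j \in S -> z \is a Num.int -> `|z - (t * j + v)| < 1 ->
     z \in Z /\ c j <= tau z) ->
  (1 - t) * c j0 + t * \sum_(j <- S) c j <= \sum_(z <- Z) tau z.
Proof.
move=> t0 t1; have [m] := ubnP #|` S|; elim: m S Z c tau j0 => // m IH S Z c tau j0.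
rewrite ltnS => cardS Sint j0S c0 tau0 near.
have [a aS amin] : exists2 x, x \in S & forall y, y \in S -> - c y <= - c x.
  by apply: ex_fset_argmax; apply/fset0Pn; exists j0.
have {}amin y : y \in S -> c a <= c y by move/amin; rewrite lerN2.
(* Since [c a] is the minimum of [c] on [S], every integer near any point of [S] lies in this
   superlevel set of [tau]; this makes the lowest layer an instance of [near_int_count]. *)
pose W := [fset z in Z | c a <= tau z]%fset.
have nearW j z : j \in S -> z \is a Num.int -> `|z - (t * j + v)| < 1 -> z \in W.
  move=> jS zint zj; have [zZ cz] := near j z jS zint zj.
  by rewrite !inE /= zZ (le_trans (amin _ jS)).
have Sn0 : S != fset0 by apply/fset0Pn; exists j0.
have cW := near_int_count t0 t1 Sn0 Sint nearW.
have WZ : (W `<=` Z)%fset by apply/fsubsetP => z; rewrite !inE => /andP[].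
have Wc : \sum_(z <- W) tau z = #|` W|%:R * c a + \sum_(z <- W) (tau z - c a).
  rewrite sumrB card_fset_sum1 natr_sum mulr_suml.
  rewrite (eq_bigr (fun=> c a) (fun _ _ => mul1r _)) addrC subrK //.
have sumW : \sum_(z <- W) tau z <= \sum_(z <- Z) tau z.
  rewrite [leRHS](big_fsetID _ (fun z => c a <= tau z)) /= lerDl.
  rewrite big_seq_cond sumr_ge0 // => z; rewrite !inE => /andP[/andP[zZ _] _].
  exact: tau0.
have Sc : \sum_(j <- S) c j = #|` S|%:R * c a + \sum_(j <- (S `\ a)%fset) (c j - c a).
  rewrite (big_fsetD1 a) //= sumrB (cardfsD1 a) aS natrD mulrDl mul1r.
  rewrite (card_fset_sum1 (S `\ a)%fset) natr_sum mulr_suml.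
  by rewrite [in RHS](eq_bigr (fun=> c a) (fun _ _ => mul1r _)); lra.
have ca0 := c0 a aS.
have W0 : 0 <= \sum_(z <- W) (tau z - c a).
  by rewrite big_seq sumr_ge0 // => z; rewrite !inE subr_ge0 => /andP[].
have key j1 : j1 \in (S `\ a)%fset -> (1 - t) * (c j1 - c a) +
    t * \sum_(j <- (S `\ a)%fset) (c j - c a) <= \sum_(z <- W) (tau z - c a).
  move=> j1S; apply: (IH (S `\ a)%fset W (fun j => c j - c a) (fun z => tau z - c a)) => //.
  - by have := cardfsD1 a S; rewrite aS => e; rewrite e in cardS.
  - by move=> j /fsetD1P[_ /Sint].
  - by move=> j /fsetD1P[_ /amin]; rewrite subr_ge0.
  - by move=> z; rewrite !inE subr_ge0 => /andP[].
  - move=> j z /fsetD1P[_ jS] zint zj; rewrite (nearW j z) // lerB //.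
    by case: (near j z jS zint zj).
have {}cW := ler_wpM2r ca0 cW.
have mid : (1 - t) * (c j0 - c a) + t * \sum_(j <- (S `\ a)%fset) (c j - c a) <=
    \sum_(z <- W) (tau z - c a).
  (* For [j0 = a] the term with [1 - t] vanishes, and any other remaining point can serve as base
     point for the induction. *)
  have [j0a|j0a] := eqVneq j0 a; last by apply: key; rewrite !inE j0a.
  rewrite {}j0a subrr mulr0 add0r.
  have [->|/fset0Pn[j1 j1S]] := eqVneq (S `\ a)%fset fset0.
    by rewrite big_seq_fset0 mulr0.
  have := key j1 j1S; have : 0 <= (1 - t) * (c j1 - c a).
    by case/fsetD1P: j1S => _ /amin ?; rewrite mulr_ge0 // subr_ge0.
  lra.
by rewrite Sc; lra.
Qed.

(** * Inequalities of Young and Hoelder *)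

(** Weighted AM-GM with integer weights, free of roots: [a] times the case d, plus (d+1) b^d (a-b)^2
    >= 0, is the case d+1. *)
Lemma young_exp (R : realType) (a b : R) (d : nat) : 0 <= a -> 0 <= b ->
  d.+1%:R * (a * b ^+ d) <= a ^+ d.+1 + d%:R * b ^+ d.+1.
Proof.
move=> a0 b0; elim: d => [|d IH]; first by rewrite !expr0 expr1; lra.
have := ler_wpM2l a0 IH.
have : 0 <= d.+1%:R * b ^+ d * (a - b) ^+ 2.
  by rewrite mulr_ge0 ?sqr_ge0 // mulr_ge0 // exprn_ge0.
rewrite -subr_ge0 => P; rewrite -subr_ge0 => Q; rewrite -subr_ge0.
have := addr_ge0 P Q; congr (0 <= _).
rewrite !exprS expr0 -![d.+2%:R]natr1 -![d.+1%:R]natr1; ring.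
Qed.

Lemma expr_root (R : realType) (x : R) (d : nat) : 0 <= x -> (0 < d)%N ->
  (x `^ d%:R^-1) ^+ d = x.
Proof.
move=> x0 d0; rewrite -powR_mulrn ?powR_ge0 // -powRrM mulVf ?powRr1 //.
by rewrite pnatr_eq0 -lt0n.
Qed.

Lemma ex_root (R : realType) (x : R) (d : nat) : 0 < x ->
  exists2 y : R, 0 < y & y ^+ d.+1 = x.
Proof.
by move=> x0; exists (x `^ d.+1%:R^-1); rewrite ?powR_gt0 // expr_root // ltW.
Qed.

(** With [p], [q] the (d+1)-th roots of the two factors on the right, it suffices that 1-t+ta <= p
    q^d. Young's inequality for (1/p, 1/q) with weight 1-t and for (r/p, s/q) with weight t gives
    this, because the right-hand sides add up to d+1. *)
Lemma hoelder_exp (R : realType) (t x b a : R) (d : nat) :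
  0 <= t -> t <= 1 -> 0 < x -> 0 < b -> 0 <= a -> a ^+ d.+1 <= x * b ^+ d ->
  (1 - t + t * a) ^+ d.+1 <= (1 - t + t * x) * (1 - t + t * b) ^+ d.
Proof.
move=> t0 t1 x0 b0 a0 axb.
have conv_gt0 y : 0 < y -> 0 < 1 - t + t * y.
  move=> y0; have [->|tn0] := eqVneq t 0; first by rewrite mul0r; lra.
  have : 0 < t * y by rewrite mulr_gt0 // lt_neqAle eq_sym tn0.
  lra.
have [p p0 pE] := ex_root d (conv_gt0 _ x0).
have [q q0 qE] := ex_root d (conv_gt0 _ b0).
have [s s0 sE] := ex_root d b0.
have pn0 := gt_eqF p0; have qn0 := gt_eqF q0; have sn0 := gt_eqF s0.
have qd0 : 0 < q ^+ d by rewrite exprn_gt0.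
have sd0 : 0 < s ^+ d by rewrite exprn_gt0.
(* As s^(d+1) = b, the hypothesis on [a] becomes r^(d+1) <= x while a = r s^d. *)
pose r := a / s ^+ d.
have r0 : 0 <= r by rewrite divr_ge0 // ltW.
have rx : r ^+ d.+1 <= x.
  by rewrite expr_div_n -exprM mulnC exprM sE ler_pdivrMr // exprn_gt0.
suff H : 1 - t + t * a <= p * q ^+ d.
  have -> : (1 - t + t * x) * (1 - t + t * b) ^+ d = (p * q ^+ d) ^+ d.+1.
    by rewrite exprMn pE -exprM mulnC exprM qE.
  rewrite lerXn2r ?nnegrE //; last by rewrite mulr_ge0 // ltW.
  by have := mulr_ge0 t0 a0; lra.
have y1 : d.+1%:R * (p^-1 * q^-1 ^+ d) <= p^-1 ^+ d.+1 + d%:R * q^-1 ^+ d.+1.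
  by apply: young_exp; rewrite invr_ge0 ltW.
have y2 : d.+1%:R * (r / p * (s / q) ^+ d) <=
     (r / p) ^+ d.+1 + d%:R * (s / q) ^+ d.+1.
  by apply: young_exp; rewrite divr_ge0 // ltW.
have P0 := conv_gt0 _ x0; have Q0 := conv_gt0 _ b0.
rewrite !exprVn pE qE in y1.
rewrite !expr_div_n pE qE sE in y2.
have {}y2 : d.+1%:R * (a / (p * q ^+ d)) <= x / (1 - t + t * x) +
    d%:R * (b / (1 - t + t * b)).
  apply: le_trans (le_trans y2 _).
    rewrite ler_wpM2l // le_eqVlt; apply/orP; left; apply/eqP.
    by rewrite /r; field; rewrite ?pn0 ?gt_eqF.
  rewrite lerD2r; apply: ler_wpM2r; first by rewrite invr_ge0 ltW.
  by rewrite -expr_div_n.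
have s1 : 0 <= 1 - t by lra.
have := lerD (ler_wpM2l s1 y1) (ler_wpM2l t0 y2).
have -> : (1 - t) * (d.+1%:R * (p^-1 / q ^+ d)) + t * (d.+1%:R * (a / (p * q ^+ d)))
  = d.+1%:R * ((1 - t + t * a) / (p * q ^+ d)).
  by field; rewrite ?pn0 ?gt_eqF.
have -> : (1 - t) * ((1 - t + t * x)^-1 + d%:R / (1 - t + t * b)) +
    t * (x / (1 - t + t * x) + d%:R * (b / (1 - t + t * b))) = d.+1%:R * 1.
  by rewrite -natr1; field; rewrite !gt_eqF.
by rewrite ler_pM2l ?ltr0n // ler_pdivrMr ?mulr_gt0 // mul1r.
Qed.

(** * A discrete Brunn-Minkowski inequality *)

Lemma card_fset_fibers (T T' : choiceType) (h : T -> T') (A : {fset T}) :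
  #|` A| = (\sum_(y <- [fset h x | x in A]%fset)
             #|` [fset x in A | h x == y]%fset|)%N.
Proof.
rewrite card_fset_sum1 (partition_big_imfset _ h).
by apply: eq_bigr => y _; rewrite card_fset_sum1 big_fset_condE.
Qed.

(* A discrete Brunn-Minkowski inequality between F and a single point, for
   translates by an arbitrary real vector v.  Slicing along one coordinate of I
   reduces it to [near_int_sum]; comparing every slice with the largest one
   leaves Hoelder's inequality. *)
Lemma lattice_brunn_minkowski (R : realType) (n : nat) (I : {set 'I_n})
    (F T : {fset 'rV[R]_n}) (t a : R) (v c : 'rV[R]_n) :
  0 <= t -> t <= 1 -> 0 <= a -> F != fset0 ->
  (forall (f : 'rV[R]_n) i, f \in F -> i \in I -> f 0 i \is a Num.int) ->
  (forall (f g : 'rV[R]_n) i, f \in F -> g \in F -> i \notin I -> f 0 i = g 0 i) ->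
  (forall f z : 'rV[R]_n, f \in F ->
    (forall i, i \in I -> z 0 i \is a Num.int /\
       `|z 0 i - (t * f 0 i + v 0 i)| < 1) ->
    (forall i, i \notin I -> z 0 i = c 0 i) -> z \in T) ->
  a ^+ #|I| <= #|` F|%:R -> (1 - t + t * a) ^+ #|I| <= #|` T|%:R.
Proof.
move=> t0 t1.
have [d dE] : exists d, #|I| = d by exists #|I|.
elim: d => [|d IH] in I F T a c dE *; move=> a0 F0 Fint Feq nearT aF.
  rewrite dE expr0 ler1n cardfs_gt0; apply/fset0Pn; exists c.
  have [f fF] := fset0Pn _ F0.
  apply: (nearT f) => // i.
  by rewrite (cards0_eq dE) inE.
have /card_gt0P[i0 i0I] : (0 < #|I|)%N by rewrite dE.
have dI' : #|I :\ i0| = d by have := cardsD1 i0 I; rewrite i0I dE => -[].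
pose S := [fset f 0 i0 | f : 'rV[R]_n in F]%fset.
pose Z := [fset f 0 i0 | f : 'rV[R]_n in T]%fset.
pose F_ j := [fset f in F | (f : 'rV[R]_n) 0 i0 == j]%fset.
pose T_ j := [fset f in T | (f : 'rV[R]_n) 0 i0 == j]%fset.
have F_0 j : j \in S -> F_ j != fset0.
  by case/imfsetP => f fF ->; apply/fset0Pn; exists f; rewrite !inE eqxx andbT.
have F_gt0 j : j \in S -> 0 < #|` F_ j|%:R :> R.
  by move=> /F_0; rewrite ltr0n cardfs_gt0.
have F_eq j (f g : 'rV[R]_n) i : f \in F_ j -> g \in F_ j -> i \notin I :\ i0 -> f 0 i = g 0 i.
  rewrite !inE => /andP[fF /eqP fj] /andP[gF /eqP gj].
  rewrite negb_and negbK => /orP[/eqP->|iI]; first by rewrite fj gj.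
  exact: Feq.
pose b j : R := #|` F_ j|%:R `^ d%:R^-1.
have b0 j : j \in S -> 0 < b j by move=> jS; rewrite powR_gt0 // F_gt0.
have bE j : j \in S -> b j ^+ d = #|` F_ j|%:R.
  (* For d = 0 there is no root to take: the left side is 1, and the slice is a singleton because
     its points agree in every coordinate. *)
  move=> jS; have [d0|dn0] := posnP d; last by rewrite expr_root // ltW // F_gt0.
  rewrite d0 expr0; have [f fF] := fset0Pn _ (F_0 j jS).
  suff -> : F_ j = [fset f]%fset by rewrite cardfs1.
  apply/fsetP => g; rewrite in_fset1; apply/idP/eqP => [gF|->//].
  apply/rowP => i; apply: (F_eq j) => //.
  by move/eqP: dI'; rewrite d0 cards_eq0 => /eqP->; rewrite inE.
have IHj j z : j \in S -> z \is a Num.int -> `|z - (t * j + v 0 i0)| < 1 ->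
    (1 - t + t * b j) ^+ d <= #|` T_ z|%:R.
  move=> jS zint zj; rewrite -dI'.
  (* Coordinate [i0] joins the fixed ones, so the prescribed row [c] receives the value [z]
     there. *)
  apply: (IH (I :\ i0) (F_ j) (T_ z) (b j)
            (\row_i (if i == i0 then z else c 0 i))) => //.
  - exact/ltW/b0.
  - exact: F_0.
  - by move=> f i; rewrite !inE => /andP[fF _] /andP[_ iI]; apply: Fint.
  - exact: F_eq.
  - move=> f w; rewrite !inE => /andP[fF /eqP fj] nw wc.
    have wz : w 0 i0 = z by rewrite wc ?inE ?eqxx // mxE eqxx.
    rewrite wz eqxx andbT; apply: (nearT f) => // i iI.
      have [->|ii0] := eqVneq i i0; first by rewrite wz fj.
      by apply: nw; rewrite !inE ii0.
    have ii0 : i != i0 by apply: contraNneq iI => ->.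
    by rewrite wc ?mxE ?(negbTE ii0) // !inE (negbTE iI) andbF.
  - by rewrite dI' bE.
have [j0 j0S j0max] : exists2 j0, j0 \in S & forall y, y \in S -> b y <= b j0.
  apply: ex_fset_argmax; have [f fF] := fset0Pn _ F0.
  by apply/fset0Pn; exists (f 0 i0); apply/imfsetP; exists f.
have conv_gt0 y : 0 < y -> 0 < 1 - t + t * y.
  move=> y0; have [->|tn0] := eqVneq t 0; first by rewrite mul0r; lra.
  have : 0 < t * y by rewrite mulr_gt0 // lt_neqAle eq_sym tn0.
  lra.
pose cc j := (1 - t + t * b j) ^+ d.
have cc0 j : j \in S -> 0 < cc j by move=> jS; rewrite exprn_gt0 // conv_gt0 // b0.
have : (1 - t) * cc j0 + t * \sum_(j <- S) cc j <= \sum_(z <- Z) #|` T_ z|%:R.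
  apply: (@near_int_sum _ _ (v 0 i0)) => //.
  - by move=> _ /imfsetP[f fF ->]; apply: Fint.
  - by move=> j jS; exact/ltW/cc0.
  - move=> j z jS zint zj; have H := IHj j z jS zint zj; split=> //.
    have : 0 < #|` T_ z|%:R :> R by apply: lt_le_trans H; exact: cc0.
    rewrite ltr0n cardfs_gt0 => /fset0Pn[w]; rewrite !inE => /andP[wT /eqP <-].
    by apply/imfsetP; exists w.
rewrite -natr_sum -(card_fset_fibers (fun w : 'rV[R]_n => w 0 i0)) => sumT.
have M0 : 0 < b j0 ^+ d by rewrite exprn_gt0 // b0.
(* After taking d-th roots this is b_j (1-t + t b_j0) <= b_j0 (1-t + t b_j), which holds since b_j
   <= b_j0. *)
have ratio j : j \in S -> #|` F_ j|%:R / b j0 ^+ d * cc j0 <= cc j.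
  move=> jS; rewrite mulrAC ler_pdivrMr // -bE // /cc -!exprMn lerXn2r ?nnegrE //.
  - by rewrite mulr_ge0 // ltW ?conv_gt0 // b0.
  - by rewrite mulr_ge0 // ltW ?conv_gt0 // b0.
  - have : 0 <= (1 - t) * (b j0 - b j) by rewrite mulr_ge0 ?subr_ge0 // j0max.
    lra.
have sumcc : #|` F|%:R / b j0 ^+ d * cc j0 <= \sum_(j <- S) cc j.
  rewrite (card_fset_fibers (fun w : 'rV[R]_n => w 0 i0)) natr_sum !mulr_suml.
  by rewrite big_seq [leRHS]big_seq; apply: ler_sum.
have {}sumT := le_trans (lerD (lexx ((1 - t) * cc j0)) (ler_wpM2l t0 sumcc)) sumT.
rewrite dE; apply: le_trans sumT; rewrite mulrA -mulrDl.
(* Here x = |F| / b_j0^d and b = b_j0, so x b^d = |F|, which dominates a^(d+1). *)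
apply: hoelder_exp => //; last by rewrite -dE divfK // gt_eqF.
  by rewrite divr_gt0 // ltr0n cardfs_gt0.
exact: b0.
Qed.

(** * Riemann sums of polynomials *)

(** One constant controls size, increment and second-order remainder together, which lets the
    induction on p X + c close: each bound uses the preceding ones for p. *)
Lemma poly_taylor_bound (R : realType) (p : {poly R}) :
  exists2 C : R, 0 <= C & forall t h : R, 0 <= t <= 1 -> 0 <= h <= 1 ->
    [/\ `|p.[t]| <= C, `|p.[t + h] - p.[t]| <= C * h
      & `|p.[t + h] - p.[t] - h * p^`().[t]| <= C * h ^+ 2].
Proof.
elim/poly_ind: p => [|p c [C C0 IH]].
  by exists 0 => // t h _ _; rewrite deriv0 !horner0 !(subr0, mulr0, normr0, mul0r).
exists (3 * C + `|c|) => [|t h tI hI]; first by rewrite addr_ge0 ?mulr_ge0.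
have [p0 p1 p2] := IH t h tI hI.
move: tI hI => /andP[t0 t1] /andP[h0 h1].
have c0 := normr_ge0 c.
have Ch : 0 <= C * h by rewrite mulr_ge0.
have Ch2 : 0 <= C * h ^+ 2 by rewrite mulr_ge0 ?sqr_ge0.
have ch : 0 <= `|c| * h by rewrite mulr_ge0.
have ch2 : 0 <= `|c| * h ^+ 2 by rewrite mulr_ge0 ?sqr_ge0.
have ChC : C * h <= C by rewrite ler_piMr.
rewrite derivD derivM derivX derivC addr0 mulr1.
rewrite !(hornerD, hornerM, hornerX, hornerC).
have scale (x B : R) : `|x| <= B -> `|t * x| <= B.
  by move=> xB; rewrite normrM ger0_norm // (le_trans _ xB) // ler_piMl.
split.
- rewrite mulrC; apply: le_trans (ler_normD _ _) _.
  by have := scale _ _ p0; lra.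
- have -> : p.[t + h] * (t + h) + c - (p.[t] * t + c) =
      t * (p.[t + h] - p.[t]) + h * ((p.[t + h] - p.[t]) + p.[t]) by ring.
  apply: le_trans (ler_normD _ _) _.
  have : `|h * ((p.[t + h] - p.[t]) + p.[t])| <= h * (C + C).
    rewrite normrM ger0_norm // ler_wpM2l //.
    by apply: le_trans (ler_normD _ _) _; rewrite lerD // (le_trans p1).
  by have := scale _ _ p1; lra.
- have -> : p.[t + h] * (t + h) + c - (p.[t] * t + c) -
      h * (p^`().[t] * t + p.[t]) =
      t * (p.[t + h] - p.[t] - h * p^`().[t]) + h * (p.[t + h] - p.[t]) by ring.
  apply: le_trans (ler_normD _ _) _.
  have : `|h * (p.[t + h] - p.[t])| <= h * (C * h).
    by rewrite normrM ger0_norm // ler_wpM2l.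
  by have := scale _ _ p2; lra.
Qed.

(** The sums are left Riemann-Stieltjes sums of [f] against -du, and P(1) - P(0) is their limit.
    Each step of length h costs at most C h^2, so N+1 equal steps cost C/(N+1), which tends to 0. *)
Lemma riemann_sum_le (R : realType) (P u f : {poly R}) (X : R) :
  P^`() = - (u^`() * f) ->
  (forall N : nat, \sum_(i < N.+1)
     (u.[i%:R / N.+1%:R] - u.[i.+1%:R / N.+1%:R]) * f.[i%:R / N.+1%:R] <= X) ->
  P.[1] - P.[0] <= X.
Proof.
move=> P' sumX.
have [C1 C10 T1] := poly_taylor_bound P.
have [C2 C20 T2] := poly_taylor_bound u.
have [C3 C30 T3] := poly_taylor_bound f.
pose C := C1 + C2 * C3.
have C0 : 0 <= C by rewrite addr_ge0 ?mulr_ge0.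
have local (t h : R) : 0 <= t <= 1 -> 0 <= h <= 1 ->
    P.[t + h] - P.[t] <= (u.[t] - u.[t + h]) * f.[t] + C * h ^+ 2.
  move=> tI hI.
  have [_ _] := T1 t h tI hI; rewrite P' hornerN hornerM.
  have [_ _ u2] := T2 t h tI hI; have [f0 _ _] := T3 t h tI hI.
  have : `|(u.[t + h] - u.[t] - h * u^`().[t]) * f.[t]| <= C2 * h ^+ 2 * C3.
    by rewrite normrM ler_pM.
  by rewrite !ler_norml /C => /andP[? ?] /andP[? ?]; lra.
have bound N : P.[1] - P.[0] <= X + C / N.+1%:R.
  pose h : R := N.+1%:R^-1.
  have hN : h * N.+1%:R = 1 by rewrite mulVf // pnatr_eq0.
  have h0 : 0 <= h by rewrite invr_ge0.
  have -> : P.[1] - P.[0] =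
      \sum_(i < N.+1) (P.[i.+1%:R / N.+1%:R] - P.[i%:R / N.+1%:R]).
    rewrite -(big_mkord xpredT (fun i => P.[i.+1%:R / N.+1%:R] - P.[i%:R / N.+1%:R])).
    rewrite (telescope_sumr (fun i => P.[i%:R / N.+1%:R])) //.
    by rewrite mul0r divff // pnatr_eq0.
  have -> : C / N.+1%:R = \sum_(i < N.+1) C * h ^+ 2.
    rewrite sumr_const card_ord -[RHS]mulr_natr expr2.
    by rewrite -[RHS]mulrA -[h * h * _]mulrA hN mulr1.
  apply: le_trans (lerD (sumX N) (lexx _)).
  rewrite -big_split /=; apply: ler_sum => i _.
  have -> : i.+1%:R / N.+1%:R = i%:R / N.+1%:R + h by rewrite -natr1 mulrDl mul1r.
  apply: local.
    by rewrite divr_ge0 //= ler_pdivrMr // mul1r ler_nat ltnW.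
  by rewrite h0 /= invf_le1 // ler1n.
rewrite leNgt; apply/negP => XP.
pose e := P.[1] - P.[0] - X.
have e0 : 0 < e by rewrite subr_gt0.
have := archi_boundP (divr_ge0 C0 (ltW e0)).
set N := Num.bound _ => CN.
have := bound N; apply/negP; rewrite -ltNge.
have CN' : C / e < N.+1%:R by rewrite (lt_le_trans CN) // ler_nat.
rewrite ltr_pdivrMr // in CN'.
have : C / N.+1%:R < e by rewrite ltr_pdivrMr // mulrC.
by rewrite /e ltrBrDl addrC.
Qed.

(** * Bernstein polynomials and the bracket as an integral *)

Lemma deriv_bernstein (R : realType) (n j : nat) : (j <= n)%N ->
  ('X^j * (1 - 'X) ^+ (n - j))^`() =
  'X^(j.-1) * (1 - 'X) ^+ (n - j) *+ j - 'X^j * (1 - 'X) ^+ (n - j).-1 *+ (n - j)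
  :> {poly R}.
Proof.
move=> jn; rewrite derivM derivXn deriv_exp derivB derivX -polyC1 derivC.
by rewrite sub0r mulN1r mulNrn mulrN mulrnAl mulrnAr.
Qed.

(** The derivative of each Bernstein polynomial is a difference of two consecutive ones of lower
    degree, so the tail telescopes; the upper end vanishes because 'C(n, n+1) = 0. *)
Lemma deriv_bernstein_tail (R : realType) (n i : nat) : (i <= n)%N ->
  (\sum_(i.+1 <= j < n.+2) ('X^j * (1 - 'X) ^+ (n.+1 - j)) *+ 'C(n.+1, j))^`() =
  ('X^i * (1 - 'X) ^+ (n - i)) *+ (n.+1 * 'C(n, i)) :> {poly R}.
Proof.
move=> le_in; rewrite raddf_sum /=.
pose g j : {poly R} := - (('X^(j.-1) * (1 - 'X) ^+ (n.+1 - j)) *+ (n.+1 * 'C(n, j.-1))).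
rewrite (eq_big_nat _ _ (F2 := fun j => g j.+1 - g j)) => [|j /andP[ij jn]].
  rewrite telescope_sumr; last by rewrite ltnS leqW.
  by rewrite /g /= (@bin_small n n.+1) // muln0 mulr0n oppr0 sub0r opprK subSS.
rewrite derivMn deriv_bernstein // /g opprK [RHS]addrC mulrnBl; congr (_ + _).
  case: j ij jn => // j _ jn; rewrite /= -mulrnA.
  by congr (_ *+ _); rewrite mul_bin_diag.
rewrite -mulrnA /=; congr (- (_ *+ _)).
  by rewrite subnS.
by rewrite [RHS](mul_bin_down n.+1 j) //; exact: mulnC.
Qed.

(** The sum equals the integral over [0,1] of k (1-t)^(k-1) (1-t+ta)^(n-k). The binomial expansion
    in [a] leaves Beta integrals of t^i (1-t)^(n-1-i), each equal to 1 / (n 'C(n-1, i)). *)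
Lemma bernstein_integral_le (R : realType) (n k : nat) (a X : R) :
  (0 < k)%N -> (k <= n)%N ->
  (forall N : nat, \sum_(i < N.+1)
     ((1 - i%:R / N.+1%:R) ^+ k - (1 - i.+1%:R / N.+1%:R) ^+ k) *
     (1 - i%:R / N.+1%:R + i%:R / N.+1%:R * a) ^+ (n - k) <= X) ->
  \sum_(0 <= i < (n - k).+1)
    k%:R / (n - i)%:R * 'C(n - k, i)%:R * 'C(n, i)%:R^-1 * a ^+ i <= X.
Proof.
move=> k0 kn sumX.
(* The antiderivative of n C(n-1,i) x^i (1-x)^(n-1-i) with value 0 at 0 and
   1 at 1. *)
pose tail i : {poly R} :=
  \sum_(i.+1 <= j < n.+1) ('X^j * (1 - 'X) ^+ (n - j)) *+ 'C(n, j).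
pose coef i : R := k%:R / (n - i)%:R * 'C(n - k, i)%:R * 'C(n, i)%:R^-1 * a ^+ i.
pose P : {poly R} := \sum_(0 <= i < (n - k).+1) coef i *: tail i.
have n0 : (0 < n)%N by apply: leq_trans kn.
have n1E : n = n.-1.+1 by rewrite prednK.
have tail1 i : (i <= n - k)%N -> (tail i).[1] = 1.
  move=> i_le; have i_lt : (i < n)%N.
    by rewrite (leq_ltn_trans i_le) // ltn_subrL k0 n0.
  rewrite /tail big_nat_recr //= hornerD hornerMn hornerM hornerXn subnn expr0.
  rewrite hornerC expr1n mulr1 binn mulr1n horner_sum big_nat big1 ?add0r // => j.
  case/andP=> _ jn; rewrite hornerMn hornerM horner_exp !hornerE subrr expr0n.
  by rewrite subn_eq0 leqNgt jn mulr0 mul0rn.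
have tail0 i : (tail i).[0] = 0.
  rewrite horner_sum big_nat big1 // => j /andP[ij _].
  rewrite hornerMn hornerM hornerXn expr0n.
  by case: j ij => // j _; rewrite mul0r mul0rn.
have := @riemann_sum_le R P ((1 - 'X) ^+ k) ((1 - 'X + 'X * a%:P) ^+ (n - k)) X.
have -> : P.[1] - P.[0] = \sum_(0 <= i < (n - k).+1) coef i.
  rewrite !horner_sum -sumrB !big_nat; apply: eq_bigr => i; rewrite ltnS => /andP[_ ik].
  by rewrite !hornerZ tail0 tail1 // mulr0 subr0 mulr1.
apply.
  rewrite deriv_exp derivB derivX -polyC1 derivC sub0r mulN1r mulNrn mulNr opprK.
  rewrite polyC1 (exprDn (1 - 'X)) mulr_sumr raddf_sum /= big_mkord.
  apply: eq_bigr => -[i /= i_le] _; rewrite ltnS in i_le.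
  have i_lt : (i < n)%N.
    by rewrite (leq_ltn_trans i_le) // ltn_subrL k0 n0.
  rewrite derivZ /tail.
  have := @deriv_bernstein_tail R n.-1 i; rewrite -n1E => -> //; last by rewrite -ltnS -n1E.
  rewrite exprMn -polyC_exp -mul_polyC -[_ *+ (n * _)]mulr_natl.
  rewrite -[_ *+ k]mulr_natl -[_ *+ 'C(n - k, i)]mulr_natl.
  have -> : (n.-1 - i = k.-1 + (n - k - i))%N.
    by lia.
  (* The identity n 'C(n-1, i) = (n-i) 'C(n, i) cancels both denominators of [coef i]. *)
  have cE : coef i * (n * 'C(n.-1, i))%:R = k%:R * 'C(n - k, i)%:R * a ^+ i.
    rewrite mul_bin_down natrM /coef; field.
    by rewrite !pnatr_eq0 -!lt0n bin_gt0 subn_gt0 i_lt ltnW.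
  rewrite exprD.
  transitivity ((coef i * (n * 'C(n.-1, i))%:R)%:P *
    ('X^i * ((1 - 'X) ^+ k.-1 * (1 - 'X) ^+ (n - k - i)))).
    by rewrite [in RHS]polyCM polyC_natr; ring.
  by rewrite cE !polyCM !polyC_natr; ring.
move=> N; apply: le_trans (sumX N); rewrite le_eqVlt; apply/orP; left; apply/eqP.
by apply: eq_bigr => i _; rewrite !(horner_exp, hornerE).
Qed.

(** * Coordinate subspaces and the orthogonal projection *)

Lemma mem_coord_space (R : realType) (n k : nat) (x : 'rV[R]_n) :
  reflect (forall i : 'I_n, (k <= i)%N -> x 0 i = 0) (x \in coord_space R n k).
Proof.
apply: (iffP idP) => [|x0].
  rewrite /coord_space; set s := map _ _; move=> /(@coord_span _ _ _ (in_tuple s)) -> i ki.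
  rewrite summxE big1 // => j _; rewrite mxE.
  have : (in_tuple s)`_j \in s by rewrite mem_nth.
  case/mapP => i'; rewrite mem_filter => /andP[i'k _] ->.
  rewrite mxE /= (_ : (i == i') = false) ?mulr0 //.
  by apply: contraTF i'k => /eqP <-; rewrite -leqNgt.
rewrite [x]matrix_sum_delta big_ord1 rpred_sum // => i _.
have [ki|ik] := leqP k i; first by rewrite x0 // scale0r rpred0.
rewrite rpredZ // memv_span //; apply/mapP; exists i => //.
by rewrite mem_filter ik mem_enum.
Qed.

Lemma dotrv_delta (R : realType) (n : nat) (x : 'rV[R]_n) (i : 'I_n) :
  dotrv x (delta_mx 0 i) = x 0 i.
Proof.
rewrite /dotrv (bigD1 i) //= mxE !eqxx mulr1 big1 ?addr0 // => j ji.
by rewrite mxE eqxx /= (negbTE ji) mulr0.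
Qed.

Lemma mem_ortho_compl (R : realType) (n : nat) (U : {vspace 'rV[R]_n}) x :
  reflect (forall y, y \in U -> dotrv x y = 0) (x \in ortho_compl U).
Proof. exact: (@mem_orthovP _ _ _ _ (@dotrv R n) U x). Qed.

Lemma mem_ortho_compl_coord (R : realType) (n k : nat) (x : 'rV[R]_n) :
  reflect (forall i : 'I_n, (i < k)%N -> x 0 i = 0)
          (x \in ortho_compl (coord_space R n k)).
Proof.
apply: (iffP (mem_ortho_compl _ _)) => [xH i ik|x0 y /mem_coord_space yH].
  rewrite -dotrv_delta; apply: xH; apply/mem_coord_space => j kj.
  by rewrite mxE eqxx -val_eqE /= gtn_eqF // (leq_trans ik).
rewrite /dotrv big1 // => i _.
by have [ki|ik] := leqP k i; [rewrite yH // mulr0 | rewrite x0 // mul0r].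
Qed.

Lemma mem_ortho_compl2_coord (R : realType) (n k : nat) (x : 'rV[R]_n) :
  reflect (forall i : 'I_n, (k <= i)%N -> x 0 i = 0)
          (x \in ortho_compl (ortho_compl (coord_space R n k))).
Proof.
apply: (iffP (mem_ortho_compl _ _)) => [xH i ki|x0 y /mem_ortho_compl_coord yH].
  rewrite -dotrv_delta; apply: xH; apply/mem_ortho_compl_coord => j jk.
  by rewrite mxE eqxx -val_eqE /= ltn_eqF // (leq_trans jk).
rewrite /dotrv big1 // => i _.
by have [ki|ik] := leqP k i; [rewrite x0 // mul0r | rewrite yH // mulr0].
Qed.

(** The projection onto the orthogonal complement of H in coordinates; the ambient dimension stays
    n. *)
Definition last_coords (R : realType) (n k : nat) (x : 'rV[R]_n) : 'rV[R]_n :=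
  \row_i (if (k <= i)%N then x 0 i else 0).

Lemma ortho_proj_coord (R : realType) (n k : nat) (x : 'rV[R]_n) :
  ortho_proj (ortho_compl (coord_space R n k)) x = last_coords k x.
Proof.
rewrite /ortho_proj; set U := ortho_compl _; set V := ortho_compl U.
have UV0 : (U :&: V = 0)%VS.
  apply/eqP; rewrite -subv0; apply/subvP => y.
  rewrite memv_cap memv0 => /andP[/mem_ortho_compl_coord yU /mem_ortho_compl2_coord yV].
  apply/eqP/rowP => i; rewrite mxE.
  by have [ki|ik] := leqP k i; [exact: yV | exact: yU].
have lU : last_coords k x \in U.
  by apply/mem_ortho_compl_coord => i ik; rewrite mxE leqNgt ik.
have rV : x - last_coords k x \in V.
  by apply/mem_ortho_compl2_coord => i ki; rewrite !mxE ki subrr.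
have VU0 : (V :&: U = 0)%VS by rewrite capvC.
(* The projections along U and V add up to the identity on U + V, and the one onto V fixes this
   vector, so the one onto U kills it. *)
have r0 : daddv_pi U V (x - last_coords k x) = 0.
  have := daddv_pi_add UV0 (subvP (addvSr U V) _ rV).
  by rewrite (daddv_pi_id VU0 rV) -[RHS]add0r => /addIr.
by rewrite -[x in LHS](subrK (last_coords k x)) linearD /= r0 add0r daddv_pi_id.
Qed.

(** * Lattice points of bounded sets, and convexity *)

Lemma finite_int_box (R : realType) (n : nat) (M : R) :
  finite_set [set x : 'rV[R]_n | forall i, x 0 i \is a Num.int /\ `|x 0 i| <= M].
Proof.
(* The box is covered by the rows with entries j - m, where 0 <= j <= 2m. *)
pose m := Num.bound M.
pose g (f : {ffun 'I_n -> 'I_(m + m).+1}) : 'rV[R]_n := \row_i ((f i)%:R - m%:R).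
apply: (@sub_finite_set _ _ (g @` setT)); last exact/finite_image/finite_finset.
move=> x xM /=.
have ex i : exists j : 'I_(m + m).+1, x 0 i = j%:R - m%:R.
  have [/intrP[z xz] xb] := xM i.
  have := le_lt_trans xb (archi_boundP (le_trans (normr_ge0 _) xb)).
  rewrite -/m xz -intr_norm -[m%:R]/((m%:Z)%:~R) ltr_int => zm.
  have h : (`|(z + m%:Z)%R|%N < (m + m).+1)%N by lia.
  exists (Ordinal h) => /=.
  rewrite -[X in _ = X - _]/((`|(z + m%:Z)%R|%N%:Z)%:~R) -rmorphB /=; congr (_%:~R).
  by lia.
have [j jE] := choice ex; exists [ffun i => j i] => //.
by apply/rowP => i; rewrite mxE ffunE jE.
Qed.

Lemma finite_int_points (R : realType) (n : nat) (I : pred 'I_n)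
    (M : set 'rV[R]_n) (B : R) :
  (forall x, M x -> forall i, `|x 0 i| <= B) -> finite_set (M `&` int_points I).
Proof.
move=> MB; apply: sub_finite_set (finite_int_box n B) => x [/MB xB xI] i.
split=> //; have := xI i; case: ifP => // _ /eqP->; exact: rpred0.
Qed.

Lemma bounded_set_coord (R : realType) (n : nat) (K : set 'rV[R]_n) :
  bounded_set K -> exists B : R, forall x, K x -> forall i, `|x 0 i| <= B.
Proof.
move=> [B [_ KB]]; exists (B + 1) => x Kx i.
have : `|x| <= B + 1 by apply: KB => //; rewrite ltrDl.
apply: le_trans.
rewrite [leRHS]mx_normrE; exact: (@le_bigmax _ _ _ _ (fun j => `|x j.1 j.2|) (0, i)).
Qed.

Lemma convex_set_segment (R : realType) (n : nat) (K : set 'rV[R]_n) :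
  convex_set K -> forall x y (t : R), 0 <= t -> t <= 1 -> K x -> K y ->
  K ((1 - t) *: x + t *: y).
Proof.
move=> Kc x y t t0 t1 Kx Ky.

have := Kc y x (Itv01 t0 t1) (mem_set Ky) (mem_set Kx).
by rewrite in_setE addrC.
Qed.

(** * Fibers over the projected lattice points and their summation *)

(** Only the first index i satisfying [P] matters: all decrements from i on telescope to at most
    g(i), which is at most [W]. *)
Lemma sum_decrements_le (R : realType) (g : nat -> R) (P : pred nat) (W : R) (N : nat) :
  (forall i, (i < N)%N -> g i.+1 <= g i) -> 0 <= g N -> 0 <= W ->
  (forall i, (i < N)%N -> P i -> g i <= W) ->
  \sum_(i < N | P i) (g i - g i.+1) <= W.
Proof.
elim: N g P => [|N IH] g P gdec gN W0 gW; first by rewrite big_ord0.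
have [P0|P0] := boolP (P 0%N).
  apply: le_trans (gW 0%N _ P0) => //.
  apply: (@le_trans _ _ (\sum_(0 <= i < N.+1) (g i - g i.+1))).
    rewrite big_mkord [leRHS](bigID (fun i : 'I_N.+1 => P i)) /= lerDl.
    by apply: sumr_ge0 => i _; rewrite subr_ge0 gdec.
  rewrite (eq_bigr (fun i => - g i.+1 - - g i)) => [|i _]; last by rewrite opprK addrC.
  by rewrite telescope_sumr // opprK addrC gerBl.
rewrite big_mkcond big_ord_recl /= (negbTE P0) add0r -big_mkcond /=.
by apply: (IH (g \o S) (P \o S)) => // i iN; [exact: gdec | exact: gW].
Qed.

Section Fibers.
Variables (R : realType) (n k : nat) (K : set 'rV[R]_n).
Variables (A B L : {fset 'rV[R]_n}).
Hypotheses (K_segment : forall x y (t : R), 0 <= t -> t <= 1 -> K x -> K y ->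
  K ((1 - t) *: x + t *: y)) (K0 : K 0).
Hypothesis AP : forall x : 'rV[R]_n, (x \in A) <->
  [/\ K x, forall i : 'I_n, (i < k)%N -> x 0 i \is a Num.int
    & forall i : 'I_n, (k <= i)%N -> x 0 i = 0].
Hypothesis BP : forall y : 'rV[R]_n, (y \in B) <->
  [/\ exists2 x, K x & y = last_coords k x
    & forall i : 'I_n, (k <= i)%N -> y 0 i \is a Num.int].
Hypothesis LP : forall z : 'rV[R]_n, (z \in L) <->
  exists2 x, K x & forall i, z 0 i \is a Num.int /\ `|z 0 i - x 0 i| < 1.

Let J := [set i : 'I_n | (i < k)%N]%SET.

(** [A], [B] and [L] stand for the lattice points of K & H, of the projection of K and of K +
    (-1,1)^n. Their membership equivalences keep [fset_set] and its finiteness conditions out of the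
    section. *)
Definition base : {fset 'rV[R]_n} := [fset last_coords k z | z : 'rV[R]_n in L]%fset.
Definition fiber (y : 'rV[R]_n) : {fset 'rV[R]_n} :=
  [fset z in L | last_coords k (z : 'rV[R]_n) == y]%fset.
(** Its cardinality is N(t). Carving it out of [base] makes it index fibers of [L]. *)
Definition shadow (t : R) : {fset 'rV[R]_n} :=
  [fset y in base | `[< exists2 p, p \in B &
     forall i : 'I_n, (k <= i)%N -> `|(y : 'rV[R]_n) 0 i - t * p 0 i| < 1 >] ]%fset.

Lemma card_first : (k <= n)%N -> #|J| = k.
Proof.
move=> kn; have widen_inj : injective (widen_ord kn).
  by move=> i j /(congr1 val) /= /val_inj.
rewrite -[RHS](card_ord k) -(card_imset _ widen_inj).
apply: eq_card => i; rewrite inE; apply/idP/imsetP => [ik|[j _ ->]].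
  by exists (Ordinal ik) => //; apply/val_inj.
by rewrite /= ltn_ord.
Qed.

Lemma zero_in_section : 0 \in A.
Proof. by apply/AP; split=> // i _; rewrite mxE ?rpred0. Qed.

Lemma zero_in_projection : 0 \in B.
Proof.
apply/BP; split=> [|i _]; last by rewrite mxE rpred0.
by exists 0 => //; apply/rowP => i; rewrite !mxE if_same.
Qed.

(** Discrete Brunn-Minkowski in the last n-k coordinates, with zero translate. What remains is that
    every integer point found there lifts to a point of [L]. *)
Lemma shadow_card (t a : R) : 0 <= t -> t <= 1 -> 0 <= a ->
  a ^+ (n - k) <= #|` B|%:R -> (k <= n)%N ->
  (1 - t + t * a) ^+ (n - k) <= #|` shadow t|%:R.
Proof.
move=> t0 t1 a0 aB kn.
have cJ : #|~: J| = (n - k)%N.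
  by apply/eqP; rewrite -(eqn_add2l k) subnKC // -[X in (X + _)%N]card_first // cardsC card_ord.
rewrite -cJ; apply: (@lattice_brunn_minkowski R n (~: J) B (shadow t) t a 0 0) => //.
- by apply/fset0Pn; exists 0; exact: zero_in_projection.
- by move=> f i /BP[_ fint]; rewrite !inE -leqNgt; exact: fint.
- move=> f g i /BP[[x _ ->] _] /BP[[y _ ->] _].
  by rewrite !inE negbK => ik; rewrite !mxE leqNgt ik.
- move=> p y pB yint y0.
  have nearp (i : 'I_n) : (k <= i)%N -> y 0 i \is a Num.int /\ `|y 0 i - t * p 0 i| < 1.
    by move=> ki; have := yint i; rewrite !inE -leqNgt mxE addr0; apply.
  rewrite !inE; apply/andP; split; last first.
    by apply/asboolP; exists p => // i /nearp[].
  have /BP[[x Kx pE] _] := pB.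
  (* The lift rounds the first k coordinates of t x down. It stays within distance 1 of t x, which
     is in K because K is convex and contains 0. *)
  pose z : 'rV[R]_n := \row_i (if (k <= i)%N then y 0 i else (Num.floor (t * x 0 i))%:~R).
  apply/imfsetP; exists z; last first.
    apply/rowP => i; rewrite !mxE; case: ifP => ki; first by rewrite ki.
    by have := y0 i; rewrite !inE negbK ltnNge ki mxE => ->.
  apply/LP; exists (t *: x).
    by have := K_segment t0 t1 K0 Kx; rewrite scaler0 add0r.
  move=> i; rewrite /z !mxE; case: ifP => ki.
    by have := nearp i ki; rewrite pE mxE ki.
  rewrite intr_int; split=> //.
  have /andP[] := floor_itv (t * x 0 i); rewrite rmorphD /= ltr_norml => ? ?.
  by apply/andP; split; lra.
- by rewrite cJ.
Qed.

(** Discrete Brunn-Minkowski in the first k coordinates, with scale 1-t, translate t x for a point x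
    of K over [p], and the last coordinates fixed to those of [y]. *)
Lemma fiber_card (t : R) y : 0 <= t -> t <= 1 -> (k <= n)%N -> (0 < k)%N ->
  y \in shadow t -> (1 - t) ^+ k * #|` A|%:R <= #|` fiber y|%:R.
Proof.
move=> t0 t1 kn k0; rewrite !inE => /andP[/imfsetP[z0 z0L yE] /asboolP[p pB yp]].
have /BP[[x Kx pE] _] := pB.
have yL (i : 'I_n) : (i < k)%N -> y 0 i = 0 by rewrite yE mxE ltnNge => /negbTE ->.
have yint (i : 'I_n) : (k <= i)%N -> y 0 i \is a Num.int.
  by move=> ki; rewrite yE mxE ki; have /LP[w _ /(_ i)[]] := z0L.
have cJ := card_first kn.
pose a : R := #|` A|%:R `^ k%:R^-1.
have aE : a ^+ k = #|` A|%:R by rewrite expr_root.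
have s0 : 0 <= 1 - t by lra.
have s1 : 1 - t <= 1 by lra.
have a0 : 0 <= a := powR_ge0 _ _.
(* The inequality gives (t + (1-t) a)^k; the summand t is discarded. *)
apply: (@le_trans _ _ ((1 - (1 - t) + (1 - t) * a) ^+ k)).
  rewrite -aE -exprMn lerXn2r ?nnegrE ?mulr_ge0 //; last by lra.
  by have := mulr_ge0 s0 a0; lra.
rewrite -cJ; apply: (@lattice_brunn_minkowski R n J A (fiber y) (1 - t) a (t *: x) y) => //.
- by apply/fset0Pn; exists 0; exact: zero_in_section.
- by move=> f i /AP[_ fint _]; rewrite !inE; exact: fint.
- move=> f g i /AP[_ _ f0] /AP[_ _ g0]; rewrite !inE -leqNgt => ki.
  by rewrite f0 // g0.
- move=> f z fA zint zy; rewrite !inE.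
  have zy' (i : 'I_n) : (k <= i)%N -> z 0 i = y 0 i.
    by move=> ki; apply: zy; rewrite !inE -leqNgt.
  have /AP[Kf _ f0] := fA.
  apply/andP; split; last first.
    apply/eqP/rowP => i; rewrite mxE; case: leqP => [/zy'//|ik].
    by rewrite yL.
  (* Since [f] vanishes in the last coordinates, this point of K agrees there with t p, which is
     within distance 1 of [y]. *)
  apply/LP; exists ((1 - t) *: f + t *: x); first exact: K_segment.
  move=> i; rewrite !mxE; have [ki|ik] := leqP k i.
    rewrite f0 // mulr0 add0r zy' // yint //; split=> //.
    by have := yp i ki; rewrite pE mxE ki.
  by have := zint i; rewrite !inE !mxE; apply.
- by rewrite cJ aE.
Qed.

(** Each factor (1-t+ta)^(n-k) is replaced by the number of points in the shadow. After exchanging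
    the sums, the weight collected by each y is at most the size of its fiber, and the fibers
    partition [L]. *)
Lemma riemann_sum_card (a : R) (N : nat) : 0 <= a -> a ^+ (n - k) <= #|` B|%:R ->
  (k <= n)%N -> (0 < k)%N ->
  \sum_(i < N.+1)
     ((1 - i%:R / N.+1%:R) ^+ k - (1 - i.+1%:R / N.+1%:R) ^+ k) *
     (1 - i%:R / N.+1%:R + i%:R / N.+1%:R * a) ^+ (n - k)
  <= #|` L|%:R / #|` A|%:R :> R.
Proof.
move=> a0 aB kn k0.
have A0 : 0 < #|` A|%:R :> R.
  by rewrite ltr0n cardfs_gt0; apply/fset0Pn; exists 0; exact: zero_in_section.
pose g i : R := (1 - i%:R / N.+1%:R) ^+ k.
pose t i : R := i%:R / N.+1%:R.
have t_ge0 i : 0 <= t i by rewrite divr_ge0.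
have t_le1 i : (i <= N.+1)%N -> t i <= 1.
  by move=> iN; rewrite ler_pdivrMr // mul1r ler_nat.
have gdec i : (i < N.+1)%N -> g i.+1 <= g i.
  move=> iN; have := t_le1 _ iN; have := t_le1 _ (ltnW iN); rewrite /t => ti ti1.
  rewrite lerXn2r ?nnegrE ?subr_ge0 // lerD2l lerN2 ler_wpM2r // ler_nat.
  exact: leqnSn.
rewrite ler_pdivlMr // mulr_suml.
rewrite (card_fset_fibers (last_coords k) L) natr_sum.
apply: (@le_trans _ _ (\sum_(i < N.+1) \sum_(y <- base | y \in shadow (t i))
    (g i - g i.+1) * #|` A|%:R)).
  apply: ler_sum => i _; rewrite [leLHS]mulrAC.
  apply: (@le_trans _ _ ((g i - g i.+1) * #|` A|%:R * #|` shadow (t i)|%:R)).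
    apply: ler_wpM2l; first by rewrite mulr_ge0 // subr_ge0 gdec.
    by apply: shadow_card => //; exact/t_le1/ltnW.
  have -> : \sum_(y <- base | y \in shadow (t i)) (g i - g i.+1) * #|` A|%:R =
      (g i - g i.+1) * #|` A|%:R * #|` [fset y in base | y \in shadow (t i)]%fset|%:R.
    rewrite big_fset_condE (card_fset_sum1 [fset y in base | _]%fset) natr_sum mulr_sumr.
    by apply: eq_bigr => y _; rewrite mulr1.
  apply: ler_wpM2l; first by rewrite mulr_ge0 // subr_ge0 gdec.
  rewrite ler_nat; apply: fsubset_leq_card; apply/fsubsetP => y ysh.
  by rewrite !inE; move: (ysh); rewrite !inE => /andP[->].
rewrite (exchange_big_dep xpredT) //= big_seq [leRHS]big_seq; apply: ler_sum => y yb.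
rewrite -mulr_suml -ler_pdivlMr //.
(* The levels t_i whose shadow contains y need not be consecutive; the fiber bound at each of them
   is all that is required. *)
apply: (@sum_decrements_le _ g (fun i => y \in shadow (t i))) => //.
- by rewrite /g divff ?pnatr_eq0 // subrr expr0n; case: (k == 0)%N.
- move=> i iN ysh; rewrite ler_pdivlMr //.
  by apply: fiber_card ysh; rewrite ?t_le1 // ltnW.
Qed.

End Fibers.

(** * Application to the lattice counts of K *)

Theorem theorem2p1 (R : realType) (n k : nat) (K : set 'rV[R]_n)
    (n_ge2 : (2 <= n)%N) (k_gt0 : (1 <= k)%N) (k_le : (k <= n - 1)%N)
    (K_convex : convex_set K) (K_bounded : bounded_set K) (K0 : K 0) :
  let H := coord_space R n k in
  let PHK := ortho_proj (ortho_compl H) @` K in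
  (\sum_(0 <= i < (n - k).+1)
      k%:R / (n - i)%:R * ('C(n - k, i))%:R * (('C(n, i))%:R)^-1
      * (lattice_count_last k PHK)%:R `^ (i%:R / (n - k)%:R))
    * (lattice_count_first k (K `&` [set` H]))%:R
  <= (lattice_count (minkowski_sum K (open_unit_cube R n)))%:R :> R.
Proof.
cbv zeta; set H := coord_space R n k; set PHK := (_ @` K).
have kn : (k <= n)%N by lia.
have nk0 : (0 < n - k)%N by lia.
have [M KM] := bounded_set_coord K_bounded.
rewrite /lattice_count_last /lattice_count_first /lattice_count.
set B := fset_set (PHK `&` _); set A := fset_set ((K `&` _) `&` _).
set L := fset_set _.
(* The three equivalences unfold [fset_set], which requires finiteness: coordinates are bounded by M
   for the section and the projection, and by M + 1 after adding the cube. *)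
have AP (x : 'rV[R]_n) : (x \in A) <->
  [/\ K x, forall i : 'I_n, (i < k)%N -> x 0 i \is a Num.int
    & forall i : 'I_n, (k <= i)%N -> x 0 i = 0].
  rewrite in_fset_set; last by apply: (@finite_int_points _ _ _ _ M) => y [/KM].
  rewrite in_setE; split=> [[[Kx _] xI]|[Kx xint x0]].
    split=> // i ik; have := xI i; rewrite /= ?ik //.
    by rewrite ltnNge ik => /eqP.
  split; first by split=> //; exact/mem_coord_space.
  by move=> i /=; case: ltnP => [/xint//|/x0 ->].
have BP (y : 'rV[R]_n) : (y \in B) <->
  [/\ exists2 x, K x & y = last_coords k x
    & forall i : 'I_n, (k <= i)%N -> y 0 i \is a Num.int].
  rewrite in_fset_set; last first.
    apply: (@finite_int_points _ _ _ _ M) => _ [x Kx <-] i.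
    rewrite ortho_proj_coord mxE; case: ifP => _; first exact: KM.
    by rewrite normr0 (le_trans _ (KM x Kx i)).
  rewrite in_setE; split=> [[[x Kx <-] yI]|[[x Kx ->] yint]].
    rewrite ortho_proj_coord in yI *; split=> [|i ki]; first by exists x.
    by have := yI i; rewrite /= ki.
  split; first by exists x => //; exact: ortho_proj_coord.
  move=> i /=; case: leqP => [/yint//|ik]; by rewrite mxE leqNgt ik.
have LP (z : 'rV[R]_n) : (z \in L) <->
  exists2 x, K x & forall i, z 0 i \is a Num.int /\ `|z 0 i - x 0 i| < 1.
  rewrite in_fset_set; last first.
    apply: (@finite_int_points _ _ _ _ (M + 1)) => _ [x Kx [y yc <-]] i.
    rewrite mxE; apply: le_trans (ler_normD _ _) _; rewrite lerD ?KM //.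
    by rewrite ler_norml; have /andP[? ?] := yc i; apply/andP; split; exact: ltW.
  rewrite in_setE; split=> [[[x Kx [y yc <-]] zI]|[x Kx xz]].
    exists x => // i; split; first exact: (zI i).
    by rewrite mxE addrAC subrr add0r ltr_norml; exact: yc.
  split; last by move=> i /=; case: (xz i).
  exists x => //; exists (z - x); last by rewrite addrC subrK.
  by move=> i; rewrite !mxE -ltr_norml; case: (xz i).
pose a : R := #|` B|%:R `^ (n - k)%:R^-1.
have a0 : 0 <= a := powR_ge0 _ _.
have aE i : #|` B|%:R `^ (i%:R / (n - k)%:R) = a ^+ i.
  by rewrite mulrC powRrM powR_mulrn.
under eq_bigr do rewrite aE.
have A0 : 0 < #|` A|%:R :> R.
  by rewrite ltr0n cardfs_gt0; apply/fset0Pn; exists 0; exact: zero_in_section AP.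
(* Dividing by |A|, positive because 0 lies in the section, isolates the bracket. *)
rewrite -ler_pdivlMr //; apply: bernstein_integral_le => // N.
apply: (riemann_sum_card (convex_set_segment K_convex) K0 AP BP LP) => //.
by rewrite expr_root.
Qed.
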